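(* Let $F$ be a field with $\operatorname{char}(F)=2$ and let $P=E\oplus Z\oplus V\oplus Fc$ be a Dedekind Poisson algebra of type (II) over $F$ (as described in the context), with active component $V$ and associated symmetric bilinear form $\beta$ on $V$. Then $$\dim_F V\le [F:F^2].$$ More precisely, for any basis $(v_i)_{i\in I}$ of $V$ over $F$, the family $(\beta(v_i,v_i))_{i\in I}$ of elements of $F$ is linearly independent over the subfield $F^2$.
   Context: $F^2=\{a^2:a\in F\}$, which is a subfield of $F$ when $\operatorname{char}(F)=2$; $[F:F^2]=\dim_{F^2}F$ (a possibly infinite cardinal). No finite-dimensionality is assumed. A Poisson algebra over $F$ is an $F$-vector space with a bilinear commutative associative multiplication $xy$ (no identity assumed) and an alternating Lie bracket $[\,,\,]$ ($[x,x]=0$ for all $x$) satisfying $[xy,z]=x[y,z]+y[x,z]$. It is Dedekind if every Poisson subalgebra (subspace closed under both operations) is a Poisson ideal (subspace $I$ with $PI\subseteq I$, $[P,I]\subseteq I$). Type (II): $P=E\oplus Z\oplus V\oplus Fc$ (direct sum of vector spaces), with $V\neq0$, $c\neq0$, either $E=0$ or $E=Fe$ with $e\neq0$, $e^2=e$; $\beta:V\times V\to F$ is a symmetric bilinear form with $\beta(v,v)\neq0$ for every $0\neq v\in V$, $\omega:V\times V\to F$ is an alternating bilinear form ($\omega(v,v)=0$ for all $v$), and the only possibly non-zero operations besides $e^2=e$ are $uv=\beta(u,v)c$ and $[u,v]=\omega(u,v)c$ for $u,v\in V$. The space $V$ is called the active component. *)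

(* Defs.v *)
From HB Require Import structures.
From mathcomp Require Import all_boot all_order all_algebra.
From mathcomp Require Import boolp classical_sets functions cardinality.

Set Implicit Arguments.
Unset Strict Implicit.
Unset Printing Implicit Defensive.

Import GRing.Theory.
Local Open Scope classical_set_scope.
Local Open Scope ring_scope.

(* The multiplication is not assumed to be unital, so P carries no MathComp
   ring structure. *)
HB.mixin Record Lmodule_isPoisson (F : fieldType) P & GRing.Lmodule F P := {
  pmul : P -> P -> P;
  plie : P -> P -> P;
  pmulC : forall x y, pmul x y = pmul y x;
  pmulA : forall x y z, pmul x (pmul y z) = pmul (pmul x y) z;
  pmul_linl : forall a x y z, pmul (a *: x + y) z = a *: pmul x z + pmul y z;
  plie_linl : forall a x y z, plie (a *: x + y) z = a *: plie x z + plie y z;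
  plie_linr : forall a x y z, plie z (a *: x + y) = a *: plie z x + plie z y;
  plie_alt : forall x, plie x x = 0;
  plie_jacobi : forall x y z,
    plie x (plie y z) + plie y (plie z x) + plie z (plie x y) = 0;
  plie_leibniz : forall x y z,
    plie (pmul x y) z = pmul x (plie y z) + pmul y (plie x z)
}.

#[short(type="poissonType")]
HB.structure Definition Poisson (F : fieldType) :=
  {P of Lmodule_isPoisson F P & GRing.Lmodule F P}.

Definition subspace (F : fieldType) (M : lmodType F) (U : set M) : Prop :=
  U 0 /\ forall (a : F) x y, U x -> U y -> U (a *: x + y).

Definition line (F : fieldType) (M : lmodType F) (x : M) : set M :=
  [set y | exists a : F, y = a *: x].

Definition direct_sum4 (F : fieldType) (M : lmodType F)
    (U1 U2 U3 U4 : set M) : Prop :=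
  (forall x, exists x1 x2 x3 x4,
     [/\ U1 x1, U2 x2, U3 x3, U4 x4 & x = x1 + x2 + x3 + x4]) /\
  (forall x1 x2 x3 x4, U1 x1 -> U2 x2 -> U3 x3 -> U4 x4 ->
     x1 + x2 + x3 + x4 = 0 -> [/\ x1 = 0, x2 = 0, x3 = 0 & x4 = 0]).

Definition subalgebra (F : fieldType) (P : poissonType F) (S : set P) : Prop :=
  [/\ subspace S,
      forall x y, S x -> S y -> S (pmul x y) &
      forall x y, S x -> S y -> S (plie x y)].

Definition ideal (F : fieldType) (P : poissonType F) (S : set P) : Prop :=
  [/\ subspace S,
      forall p x, S x -> S (pmul p x) &
      forall p x, S x -> S (plie p x)].

Definition dedekind (F : fieldType) (P : poissonType F) : Prop :=
  forall S : set P, subalgebra S -> ideal S.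

(* A bilinear form V x V -> F is represented by a function on the ambient
   space of which only the values on V x V are constrained or used. *)
Definition bilinear_on (F : fieldType) (M : lmodType F) (V : set M)
    (b : M -> M -> F) : Prop :=
  (forall a x y z, V x -> V y -> V z -> b (a *: x + y) z = a * b x z + b y z) /\
  (forall a x y z, V x -> V y -> V z -> b z (a *: x + y) = a * b z x + b z y).

Record typeII (F : fieldType) (P : poissonType F) (E Z V : set P) (c : P)
    (beta omega : P -> P -> F) : Prop := {
  typeII_subE : subspace E;
  typeII_subZ : subspace Z;
  typeII_subV : subspace V;
  typeII_direct : direct_sum4 E Z V (line c);
  typeII_V_neq0 : exists2 v, V v & v <> 0;
  typeII_c_neq0 : c <> 0;
  typeII_E : E = [set 0] \/ exists e, [/\ e <> 0, E = line e & pmul e e = e];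
  typeII_beta_bilin : bilinear_on V beta;
  typeII_beta_sym : forall u v, V u -> V v -> beta u v = beta v u;
  typeII_beta_aniso : forall v, V v -> v <> 0 -> beta v v <> 0;
  typeII_omega_bilin : bilinear_on V omega;
  typeII_omega_alt : forall v, V v -> omega v v = 0;
  typeII_mulV : forall u v, V u -> V v -> pmul u v = beta u v *: c;
  typeII_lieV : forall u v, V u -> V v -> plie u v = omega u v *: c;
  typeII_mulEV : forall e v, E e -> V v -> pmul e v = 0;
  typeII_lieE : forall e x, E e -> plie e x = 0;
  typeII_mulZ : forall z x, Z z -> pmul z x = 0;
  typeII_lieZ : forall z x, Z z -> plie z x = 0;
  typeII_mulc : forall x, pmul c x = 0;
  typeII_liec : forall x, plie c x = 0
}.

Definition squares (F : fieldType) : set F := [set x | exists a : F, x = a ^+ 2].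
Arguments squares F : clear implicits.

(* Linear algebra over a subfield K of F: the space M is an F-vector space
   regarded as a K-vector space, and the coefficients range over K; K = setT
   gives the notions over F itself. A finite subfamily of (v_i) is an injective
   enumeration f : 'I_n -> I of its indices. *)
Definition lin_indep (F : fieldType) (K : set F) (M : lmodType F) (I : Type)
    (v : I -> M) : Prop :=
  forall (n : nat) (f : 'I_n -> I) (k : 'I_n -> F),
    injective f -> (forall i, K (k i)) ->
    \sum_(i < n) k i *: v (f i) = 0 -> forall i, k i = 0.

Definition lin_span (F : fieldType) (K : set F) (M : lmodType F) (I : Type)
    (v : I -> M) : set M :=
  [set x | exists (n : nat) (f : 'I_n -> I) (k : 'I_n -> F),
     (forall i, K (k i)) /\ x = \sum_(i < n) k i *: v (f i)].

Definition is_basis (F : fieldType) (K : set F) (M : lmodType F) (U : set M)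
    (I : Type) (v : I -> M) : Prop :=
  lin_indep K v /\ lin_span K v = U.

Definition subfield_set (F : fieldType) (K : set F) : Prop :=
  [/\ K 1, forall x y, K x -> K y -> K (x - y) &
      forall x y, K x -> K y -> K (x / y)].

Lemma squares_subfield (F : fieldType) :
  2%N \in [pchar F] -> subfield_set (squares F).
Proof.
move=> ch; split.
- by exists 1; rewrite expr1n.
- move=> _ _ [a ->] [b ->]; exists (a - b).
  rewrite sqrrB -mulr_natr (pcharf0 ch) mulr0 subr0.
  by rewrite (oppr_pchar2 ch).
- by move=> _ _ [a ->] [b ->]; exists (a / b); rewrite expr_div_n.
Qed.

Lemma basis_exists (F : fieldType) (K : set F) (M : lmodType F) (U : set M) :
  subfield_set K -> U 0 ->
  (forall a x y, K a -> U x -> U y -> U (a *: x + y)) ->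
  exists (I : Type) (v : I -> M), is_basis K U v.
Proof.
move=> [K1 KB KV] U0 UL.
have K0 : K 0 by rewrite -(subrr 1); exact: KB.
have KN a : K a -> K (- a) by move=> Ka; rewrite -sub0r; exact: KB.
pose indep (B : set M) := forall n (f : 'I_n -> M) (k : 'I_n -> F),
  injective f -> (forall i, B (f i)) -> (forall i, K (k i)) ->
  \sum_(i < n) k i *: f i = 0 -> forall i, k i = 0.
have [|B [[BU Bi] Bmax]] := @Zorn_bigcup M [set B | B `<=` U /\ indep B].
  move=> C CP Ctot; split; first by move=> x [X /CP[XU _] /XU].
  move=> n f k finj fC kK fk0 i.
  have [X CX Xs] : exists2 X, C X & forall j, j \in enum 'I_n -> X (f j).
    elim: (enum _) => [|j s [X CX Xs]].
      by have [X CX _] := fC i; exists X.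
    have [Y CY Yj] := fC j.
    have [XY|YX] := Ctot _ _ CX CY.
      by exists Y => // l; rewrite inE => /orP[/eqP->//|/Xs/XY].
    by exists X => // l; rewrite inE => /orP[/eqP->|/Xs//]; exact: YX.
  have [_ Xi] := CP _ CX.
  by apply: Xi fk0 i => // j; apply: Xs; rewrite mem_enum.
exists {x | B x}, sval; split.
  move=> n f k finj kK fk0; apply: (Bi _ (sval \o f)) => //.
    by move=> i j /= fij; apply: finj; exact: eq_sig_hprop fij.
  by move=> i; exact: svalP.
apply/seteqP; split => x.
  move=> [n [f [k [kK ->]]]] {x}.
  elim/big_ind : _ => // [y z Uy Uz|i _].
    by rewrite -[y]scale1r; exact: UL.
  by rewrite -[_ *: _]addr0; apply: UL => //; apply/BU/svalP.
move=> Ux; apply: contrapT => nx.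
have nBx : ~ B x.
  move=> Bx; apply: nx; exists 1%N, (fun=> exist _ x Bx), (fun=> 1).
  by rewrite big_ord1 scale1r.
apply: (Bmax (B `|` [set x])).
  split; first exact: subsetUl.
  by move=> /(_ x (or_intror erefl)).
split; first by move=> y [/BU//|->].
move=> n f k finj fB kK fk0.
have [[j fj]|nf] := pselect (exists j, f j = x); last first.
  apply: Bi fk0 => // i; have [//|fx] := fB i.
  by case: nf; exists i.
case: n => [|n] in f k finj fB kK fk0 j fj *; first by case: j fj.
move: fk0; rewrite (bigD1_ord j)//= fj => E.
have fB' i : B (f (lift j i)).
  have [//|fx] := fB (lift j i).
  by have /finj/eqP := etrans fj (esym fx); rewrite (negbTE (neq_lift _ _)).
have [kj0|kj0] := eqVneq (k j) 0.
  move: E; rewrite kj0 scale0r add0r => fk0 i.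
  have [i' ->|->//] := unliftP j i.
  by apply: (Bi _ (f \o lift j) (k \o lift j)) fk0 i'
    => [a b /finj/lift_inj|a|a] /=.
case: nx; exists n, (fun i => exist _ _ (fB' i)), (fun i => - k (lift j i) / k j).
split; first by move=> i; apply: KV => //; exact: KN.
apply: (scalerI kj0); move/eqP: E; rewrite addr_eq0 => /eqP ->.
rewrite scaler_sumr -sumrN; apply: eq_bigr => i _ /=.
by rewrite scalerA mulrCA mulfV// mulr1 scaleNr.
Qed.

(* dim_K U <= dim_L W for a K-subspace U and an L-subspace W, compared as
   possibly infinite cardinals, a dimension being the cardinal of the index set
   of a basis; such bases exist by basis_exists. *)
Definition dim_le (F : fieldType) (K : set F) (M : lmodType F) (U : set M)
    (L : set F) (N : lmodType F) (W : set N) : Prop :=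
  forall (I J : Type) (v : I -> M) (w : J -> N),
    is_basis K U v -> is_basis L W w -> ([set: I] #<= [set: J])%card.

(* Main.v *)
Require Import Defs.
From HB Require Import structures.
From mathcomp Require Import all_boot all_order all_algebra.
From mathcomp Require Import boolp classical_sets functions cardinality.

Set Implicit Arguments.
Unset Strict Implicit.
Unset Printing Implicit Defensive.

Import GRing.Theory.
Local Open Scope classical_set_scope.
Local Open Scope ring_scope.

(** In characteristic 2 the diagonal q(x) = beta(x, x) of a symmetric bilinear
    form is additive, because the cross terms beta(x, y) + beta(y, x) = 2 beta(x, y)
    vanish, and it is semilinear for the Frobenius map: q(a x) = a^2 q(x).  A
    dependency over F^2 between the q(v_i), with coefficients a_i^2, is therefore
    the value of q at x = sum a_i v_i.  As beta is anisotropic, x = 0, and all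
    a_i vanish because the v_i are independent over F
    ([sum_sqr_bilinear_diag]).

    The dimension inequality then asks that an independent family, here
    (q(v_i)) in the F^2-space F, be no larger than a spanning one, where both may
    be infinite.  This is Steinitz exchange run transfinitely
    ([lin_indep_card_le_span]): among the partial injections from
    the indices I of an independent family v to those J of a spanning family w,
    take by Zorn's lemma one that is maximal for the property that replacing
    v_i by the w_j matched to it keeps the family independent.  If some v_i were
    unmatched, the other members of the mixed family would not span v_i, hence
    would miss some w_j; matching i to that j contradicts maximality.  So every
    index is matched, and two indices matched to the same j would give an
    independent family with a repeated member. *)

(** * Linear independence and span over a subfield *)

Lemma subfield_set_ops (F : fieldType) (K : set F) : subfield_set K ->
  [/\ K 0, forall x, K x -> K (- x), forall x y, K x -> K y -> K (x + y) &
      forall x y, K x -> K y -> K (x * y)].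
Proof.
move=> [K1 KB KDiv]; have K0 : K 0 by rewrite -(subrr 1); exact: KB.
have KN x : K x -> K (- x) by move=> Kx; rewrite -sub0r; exact: KB.
split=> // x y Kx Ky; first by rewrite -[y]opprK; apply: KB => //; exact: KN.
by rewrite -[y]invrK; apply: (KDiv) => //; rewrite -div1r; exact: KDiv.
Qed.

(** Finite subfamilies listed as duplicate-free sequences of indices, with
    coefficients indexed by I itself, allow one to pick out or modify the term of
    a given index, which is what exchange arguments do. *)
Lemma lin_indepP (F : fieldType) (K : set F) (M : lmodType F) (I : eqType)
    (v : I -> M) : K 0 ->
  lin_indep K v <->
  forall (s : seq I) (k : I -> F), uniq s -> (forall i, K (k i)) ->
    \sum_(i <- s) k i *: v i = 0 -> {in s, forall i, k i = 0}.
Proof.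
move=> K0; split=> [vi s k us Kk sum0 i /(tnthP (in_tuple s))[m ->]|
  vi n f k finj Kk sum0 m].
  apply: (vi (size s) (tnth (in_tuple s)) (fun m => k (tnth (in_tuple s) m))).
  - by apply/tuple_uniqP.
  - by move=> ?; exact: Kk.
  - by rewrite -(big_tnth _ _ s xpredT (fun i => k i *: v i)).
(* Transport the coefficients from positions to indices, with 0 off the range
   of f. *)
pose k' i := if [pick m | f m == i] is Some m then k m else 0.
have k'f m' : k' (f m') = k m'.
  by rewrite /k'; case: pickP => [j /eqP/finj->//|/(_ m')/eqP].
rewrite -k'f; apply: (vi (map f (enum 'I_n)) k').
- by rewrite map_inj_uniq// enum_uniq.
- by move=> i; rewrite /k'; case: pickP.
- rewrite big_map big_enum/= -[RHS]sum0; apply: eq_bigr => j _.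
  by rewrite k'f.
- by rewrite map_f// mem_enum.
Qed.

(** The combinations that make up a span may repeat indices; collecting the
    coefficients of equal indices makes them comparable with independence. *)
Lemma lin_span_uniq (F : fieldType) (K : set F) (M : lmodType F) (I : eqType)
    (v : I -> M) (x : M) : subfield_set K -> lin_span K v x ->
  exists (s : seq I) (k : I -> F),
    [/\ uniq s, forall i, K (k i) & x = \sum_(i <- s) k i *: v i].
Proof.
move=> /subfield_set_ops[K0 _ KD _] [n [f [k [Kk ->]]]].
exists (undup (map f (enum 'I_n))), (fun i => \sum_(m < n | f m == i) k m).
split; first exact: undup_uniq.
  by move=> i; elim/big_ind : _.
under [RHS]eq_bigr do rewrite scaler_suml.
rewrite (exchange_big_dep xpredT)//=; apply: eq_bigr => m _.
rewrite -big_filter (_ : [seq _ <- _ | _] = [:: f m]) ?big_seq1//.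
rewrite (eq_filter (a2 := pred1 (f m))) => [|i]; last by rewrite /= eq_sym.
rewrite filter_pred1_uniq ?undup_uniq// mem_undup.
by rewrite map_f// mem_enum.
Qed.

Lemma lin_span_comb (F : fieldType) (K : set F) (M : lmodType F) (I : Type)
    (v : I -> M) (a : F) (x y : M) : subfield_set K ->
  K a -> lin_span K v x -> lin_span K v y -> lin_span K v (a *: x + y).
Proof.
move=> /subfield_set_ops[_ _ _ KM] Ka [n [f [k [Kk ->]]]] [m [g [l [Kl ->]]]].
exists (n + m)%N,
  (fun i => match fintype.split i with inl j => f j | inr j => g j end),
  (fun i => match fintype.split i with inl j => a * k j | inr j => l j end).
split; first by move=> i; case: fintype.split => // j; exact: KM.
rewrite big_split_ord/= scaler_sumr; congr (_ + _); apply: eq_bigr => j _.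
  by rewrite (unsplitK (inl j)) scalerA.
by rewrite (unsplitK (inr j)).
Qed.

Lemma lin_span_trans (F : fieldType) (K : set F) (M : lmodType F) (I J : Type)
    (v : I -> M) (w : J -> M) : subfield_set K ->
  (forall j, lin_span K v (w j)) -> lin_span K w `<=` lin_span K v.
Proof.
move=> Ksub wv _ [n [f [k [Kk ->]]]].
elim/big_rec : _ => [|i x _ vx]; last exact: lin_span_comb.
have [K0 _ _ _] := subfield_set_ops Ksub.
exists 0%N, (fun i : 'I_0 => match notF (ltn_ord i) with end), (fun=> 0).
by split=> //; rewrite big_ord0.
Qed.

(** Setting the member of index i0 to zero, rather than deleting it, expresses
    the span of the other members without changing the index type. *)
Lemma lin_indep_notin_span (F : fieldType) (K : set F) (M : lmodType F)
    (I : eqType) (v : I -> M) (i0 : I) : subfield_set K ->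
  lin_indep K v -> ~ lin_span K [eta v with i0 |-> 0] (v i0).
Proof.
move=> Ksub; have [K0 KN _ _] := subfield_set_ops Ksub.
have K1 : K 1 by case: Ksub.
move=> /(lin_indepP _ K0) vi /(lin_span_uniq Ksub)[s [k [us Kk vE]]].
pose k' := [eta k with i0 |-> -1].
have : k' i0 = 0.
  apply: (vi (i0 :: [seq i <- s | i != i0]) k').
  - by rewrite /= filter_uniq// mem_filter eqxx.
  - by move=> i /=; case: ifP => // _; exact: KN.
  - rewrite big_cons /= eqxx scaleN1r; apply/eqP; rewrite addrC subr_eq0.
    rewrite vE big_filter [X in _ == X](bigID (xpredC1 i0))/=.
    rewrite [X in _ == _ + X]big1 ?addr0; last first.
      by move=> i; rewrite negbK => ->; rewrite scaler0.
    by apply/eqP/eq_bigr => i /negbTE ->.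
  - exact: mem_head.
by move/eqP; rewrite /k' /= eqxx oppr_eq0 oner_eq0.
Qed.

(** A dependency of the modified family has a nonzero coefficient at i0, since
    otherwise it is one of v; solving it for the new member x puts x in the
    span of the others. *)
Lemma lin_indep_replace (F : fieldType) (K : set F) (M : lmodType F)
    (I : eqType) (v : I -> M) (i0 : I) (x : M) : subfield_set K ->
  lin_indep K v -> ~ lin_span K [eta v with i0 |-> 0] x ->
  lin_indep K [eta v with i0 |-> x].
Proof.
move=> Ksub; have [K0 KN _ KM] := subfield_set_ops Ksub.
have KV a : K a -> K a^-1 by case: Ksub => K1 _ + Ka => /(_ 1 a K1 Ka); rewrite div1r.
move=> /(lin_indepP _ K0) vi nx; apply/(lin_indepP _ K0) => s k us Kk sum0.
have [/andP[i0s ki0]|] := boolP ((i0 \in s) && (k i0 != 0)).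
  case: nx; pose t := rem i0 s.
  exists (size t), (tnth (in_tuple t)),
    (fun m => - (k i0)^-1 * k (tnth (in_tuple t) m)).
  split=> [m|]; first by apply: KM => //; apply/KN/KV.
  rewrite -(big_tnth _ _ t xpredT
    (fun i => (- (k i0)^-1 * k i) *: [eta v with i0 |-> 0] i)).
  move: sum0; rewrite (big_rem i0)//= eqxx => /eqP; rewrite addr_eq0 => /eqP sumE.
  rewrite -[x]scale1r -(mulVf ki0) -scalerA sumE scalerN -scaleNr scaler_sumr.
  rewrite !big_seq; apply: eq_bigr => i.
  by rewrite mem_rem_uniq// => /andP[/negbTE /= ->]; rewrite scalerA.
rewrite negb_and negbK => k0; apply: (vi s k) => //.
rewrite -[RHS]sum0 !big_seq; apply: eq_bigr => i si /=.
case: eqP => // ii0; move: k0; rewrite -ii0 si /= => /eqP ->.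
by rewrite !scale0r.
Qed.

Lemma lin_indep_inj (F : fieldType) (K : set F) (M : lmodType F) (I : Type)
    (v : I -> M) : subfield_set K -> lin_indep K v -> injective v.
Proof.
move=> Ksub vi i j vij; apply: contrapT => ij.
have [_ KN _ _] := subfield_set_ops Ksub; have K1 : K 1 by case: Ksub.
pose f (m : 'I_2) := if m == 0 then i else j.
pose k (m : 'I_2) : F := if m == 0 then 1 else -1.
have /eqP : k 0 = 0.
  apply: (vi 2%N f k).
  - by case=> [[|[|?]] ?] [[|[|?]] ?]; rewrite /f//= => ?;
      (exact: val_inj || by case: ij).
  - by move=> m; rewrite /k; case: ifP => // _; exact: KN.
  - by rewrite big_ord_recl big_ord1 /f /k /= vij scale1r scaleN1r subrr.
by rewrite /k eqxx oner_eq0.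
Qed.

(** * Transfinite Steinitz exchange *)

(** When G is a partial function, this is the family v in which v i is replaced
    by w j for every pair (i, j) of G.  Encoding the partial function by its graph
    turns extension into inclusion, so that upper bounds of chains are unions. *)
Definition exchange (I J : Type) (M : Type) (v : I -> M) (w : J -> M)
    (G : set (I * J)) (i : I) : M :=
  if pselect (exists j, G (i, j)) is left ex then w (projT1 (cid ex)) else v i.

Definition functional_rel (I J : Type) (G : set (I * J)) : Prop :=
  forall i j j', G (i, j) -> G (i, j') -> j = j'.

Lemma exchange_in (I J M : Type) (v : I -> M) (w : J -> M) (G : set (I * J)) i j :
  functional_rel G -> G (i, j) -> exchange v w G i = w j.
Proof.
move=> Gfun Gij; rewrite /exchange; case: pselect => [ex|[]]; last by exists j.
by case: cid => j' /= /(Gfun _ _ _ Gij) ->.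
Qed.

Lemma exchange_out (I J M : Type) (v : I -> M) (w : J -> M) (G : set (I * J)) i :
  ~ (exists j, G (i, j)) -> exchange v w G i = v i.
Proof. by move=> nG; rewrite /exchange; case: pselect. Qed.

(** A dependency involves finitely many indices, and each of those matched in
    the union is already matched at some stage of the chain; the largest of these
    stages agrees with the union on all of them, and is independent. *)
Lemma exchange_bigcup (F : fieldType) (K : set F) (M : lmodType F) (I J : Type)
    (v : I -> M) (w : J -> M) (C : set (set (I * J))) :
  lin_indep K v -> total_on C subset ->
  (forall G, C G -> functional_rel G /\ lin_indep K (exchange v w G)) ->
  functional_rel (\bigcup_(G in C) G) /\
  lin_indep K (exchange v w (\bigcup_(G in C) G)).
Proof.
move=> vi Ctot CP; set U := \bigcup_(G in C) G.
have Ufun : functional_rel U.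
  move=> i j j' [G CG Gij] [G' CG' Gij'].
  have [GG'|GG'] := Ctot _ _ CG CG'.
  - by have [+ _] := CP _ CG'; apply; [exact: GG' Gij|exact: Gij'].
  - by have [+ _] := CP _ CG; apply; [exact: Gij|exact: GG' Gij'].
split=> // n f k finj Kk sum0.
have [G [GU Gi GP]] : exists G, [/\ G `<=` U, lin_indep K (exchange v w G) &
    forall m, exchange v w G (f m) = exchange v w U (f m)].
  (* For the empty chain, the stage is the unmodified family v. *)
  have [[G0 CG0]|C0] := pselect (exists G, C G); last first.
    exists set0; have nU i : ~ exists j, U (i, j).
      by move=> [j [G CG _]]; apply: C0; exists G.
    have n0 i : ~ exists j : J, (set0 : set (I * J)) (i, j) by case.
    split=> // [|m]; last by rewrite !exchange_out.
    by rewrite (_ : exchange v w set0 = v)//; apply/funext => i; rewrite exchange_out.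
  have [G CG GP] : exists2 G, C G &
      forall m, m \in enum 'I_n -> forall j, U (f m, j) -> G (f m, j).
    elim: (enum _) => [|m s [G CG GP]]; first by exists G0.
    have [[j [G' CG' Gmj]]|nU] := pselect (exists j, U (f m, j)); last first.
      exists G => // m'; rewrite inE => /orP[/eqP -> j Uj|/GP//].
      by case: nU; exists j.
    have jE j' : U (f m, j') -> j' = j.
      by move=> Uj'; apply: Ufun Uj' _; exists G'.
    have [GG'|GG'] := Ctot _ _ CG CG'.
      exists G' => // m'; rewrite inE => /orP[/eqP -> j' /jE ->//|].
      by move=> /GP + j' => /[apply] /GG'.
    exists G => // m'; rewrite inE => /orP[/eqP -> j' /jE ->|/GP//].
    exact: GG' Gmj.
  have [Gfun Gi] := CP _ CG.
  have GU : G `<=` U by move=> p Gp; exists G.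
  exists G; split=> // m.
  have [[j Uj]|nU] := pselect (exists j, U (f m, j)).
    by rewrite !(@exchange_in _ _ _ _ _ _ _ j)//; apply: GP; rewrite ?mem_enum.
  by rewrite !exchange_out// => -[j /GU Uj]; apply: nU; exists j.
apply: (Gi n f k) => //.
by rewrite -[RHS]sum0; apply: eq_bigr => m _; rewrite GP.
Qed.

(** A maximal independence-preserving partial exchange of members of v for
    members of w is defined on all of I, and it is injective because an
    independent family has no repetitions. *)
Lemma lin_indep_card_le_span (F : fieldType) (K : set F) (M : lmodType F)
    (I J : Type) (v : I -> M) (w : J -> M) : subfield_set K ->
  lin_indep K v -> lin_span K w = setT -> ([set: I] #<= [set: J])%card.
Proof.
move=> Ksub vi wT.
have [G [[Gfun Gi] Gmax]] := @Zorn_bigcup (I * J)%type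
  [set G | functional_rel G /\ lin_indep K (exchange v w G)]
  (fun C CP Ctot => exchange_bigcup vi Ctot CP).
have /choice[g gP] : forall i, exists j, G (i, j).
  move=> i0; apply: contrapT => nG.
  pose I' := {classic I}.
  pose u : I' -> M := exchange v w G.
  (* If all w j were in the span of the other members, so would u i0 be. *)
  have [j wj] : exists j, ~ lin_span K [eta u with (i0 : I') |-> 0] (w j).
    apply/existsNP => wspan.
    apply: (@lin_indep_notin_span _ K _ _ u (i0 : I')) => //.
    by apply: lin_span_trans wspan _ _ => //; rewrite wT.
  pose G' := G `|` [set ((i0 : I), j)].
  have G'fun : functional_rel G'.
    move=> i j1 j2 [G1|[i1 ->]] [G2|[i2 ->]] //.
    - exact: Gfun G1 G2.
    - by case: nG; exists j1; rewrite -i2.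
    - by case: nG; exists j2; rewrite -i1.
  apply: (Gmax G').
    split; first exact: subsetUl.
    by move=> /(_ (i0, j) (or_intror erefl)) Gij; apply: nG; exists j.
  split=> //.
  rewrite (_ : exchange v w G' = [eta u with (i0 : I') |-> w j]).
    exact: (@lin_indep_replace _ K _ I' u i0 (w j) Ksub Gi wj).
  apply/funext => i /=; case: eqP => [->|ne].
    by rewrite (@exchange_in _ _ _ _ _ _ _ j)//; right.
  have [[j' Gj']|nGi] := pselect (exists j, G (i, j)).
    by rewrite /u !(@exchange_in _ _ _ _ _ _ _ j')//; left.
  rewrite /u !exchange_out// => -[j' [Gj'|[/ne]]]//.
  by apply: nGi; exists j'.
have ginj : injective g.
  move=> i i' gii'; apply: (lin_indep_inj Ksub Gi).
  by rewrite (exchange_in _ _ Gfun (gP i)) (exchange_in _ _ Gfun (gP i')) gii'.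
have /injfunPex[h] : exists2 f : I -> J, set_fun setT setT f & set_inj setT f.
  by exists g => // i i' _ _ /ginj.
exact: inj_card_le h.
Qed.

(** * The quadratic map of a symmetric form in characteristic 2 *)

(** The cross terms occur twice by symmetry, hence cancel.  Membership in V is
    part of the conclusion because bilinearity is only available on V, so the
    induction needs the partial sums to stay there. *)
Lemma sum_sqr_bilinear_diag (F : fieldType) (M : lmodType F) (V : set M)
    (beta : M -> M -> F) (n : nat) (k : 'I_n -> F) (x : 'I_n -> M) :
  2%N \in [pchar F] -> subspace V -> bilinear_on V beta ->
  (forall u v, V u -> V v -> beta u v = beta v u) -> (forall i, V (x i)) ->
  V (\sum_(i < n) k i *: x i) /\
  beta (\sum_(i < n) k i *: x i) (\sum_(i < n) k i *: x i) =
    \sum_(i < n) k i ^+ 2 * beta (x i) (x i).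
Proof.
move=> ch [V0 VL] [bl br] bs Vx.
elim/big_rec2 : _ => [|i q y _ [Vy qy]].
  split=> //; have := bl (-1) 0 0 0 V0 V0 V0.
  by rewrite scaler0 addr0 mulN1r addNr.
have Vi := Vx i; split; first exact: VL.
rewrite bl ?br//; last exact: VL.
rewrite (bs y (x i))// qy mulrDr mulrA -expr2 -!addrA; congr (_ + _).
by rewrite addrA (addrr_pchar2 ch) add0r.
Qed.

Theorem proposition8p2 (F : fieldType) (P : poissonType F)
    (E Z V : set P) (c : P) (beta omega : P -> P -> F)
    (char2 : 2%N \in [pchar F])
    (dedP : dedekind P)
    (PII : typeII E Z V c beta omega) :
  dim_le [set: F] V (squares F) [set: F^o] /\
  (forall (I : Type) (v : I -> P), is_basis [set: F] V v ->
     lin_indep (squares F) (fun i => beta (v i) (v i) : F^o)).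
Proof.
have indep (I : Type) (v : I -> P) : is_basis [set: F] V v ->
    lin_indep (squares F) (fun i => beta (v i) (v i) : F^o).
  move=> [vi vV] n f k finj /choice[a kE] sum0 i.
  have Vv j : V (v j).
    rewrite -vV; exists 1%N, (fun=> j), (fun=> 1).
    by rewrite big_ord1 scale1r.
  have [Vx qx] := sum_sqr_bilinear_diag a char2 (typeII_subV PII)
    (typeII_beta_bilin PII) (typeII_beta_sym PII) (fun m => Vv (f m)).
  rewrite kE (vi n f a) ?expr0n//.
  apply: contrapT => /(typeII_beta_aniso PII Vx); apply.
  by rewrite qx -[RHS]sum0; apply: eq_bigr => m _; rewrite kE.
split=> // I J v w vV [_ wT].
exact: lin_indep_card_le_span (squares_subfield char2) (indep _ _ vV) wT.
Qed.
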